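(* Consider a bipartite composition of two generalized probabilistic systems $A$ and $B$, each of operational dimension $2$ and each satisfying preparation-measurement reciprocity. Let $\Phi$ be a pure entangled bipartite state, let $\omega_A\otimes\omega_B$ be a pure product state, and let $0<\epsilon<1$. Then the mixed preparation $W=\epsilon\,\Phi+(1-\epsilon)\,\omega_A\otimes\omega_B$ does not exhibit Hardy nonlocality: there are no dichotomic measurements $\mathcal M_x^A=\{E_x^{A+},E_x^{A-}\}$ on $A$ and $\mathcal N_y^B=\{E_y^{B+},E_y^{B-}\}$ on $B$ ($x,y\in\{1,2\}$) such that on $W$ $$P(E_1^{A+},E_1^{B+})>0,\quad P(E_1^{A+},E_2^{B+})=0,\quad P(E_2^{A+},E_1^{B+})=0,\quad P(E_2^{A-},E_2^{B-})=0 .$$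
   Context: Generalized probabilistic system $S$: the normalized state space $\Omega_S$ is a compact convex set in a finite-dimensional real vector space $V$; its extreme points are the pure states. Effects are linear functionals $e$ with $0\le e(\omega)\le 1$ on $\Omega_S$; the unit effect $u$ satisfies $u(\omega)=1$ for all $\omega$; $\mathcal E_S$ denotes the set of all effects (no-restriction hypothesis), a compact convex set whose extreme points are the extremal effects. A measurement is a finite collection of effects summing to $u$; a dichotomic measurement is $\{e,u-e\}$. Bipartite composition: states $\omega_{AB}\in V_A\otimes V_B$ satisfy $(u_A\otimes u_B)(\omega_{AB})=1$ and $(e\otimes f)(\omega_{AB})\ge 0$ for all $e\in\mathcal E_A,f\in\mathcal E_B$; all product states $\omega_A\otimes\omega_B$ are included. A pure bipartite state is an extreme point of the bipartite state space; it is entangled if it is not a product state. The joint probability of local effects is $P(E,F)=(E\otimes F)(\omega_{AB})$. Operational dimension (OD): the maximal number $m$ of states $\omega_1,\dots,\omega_m$ that are perfectly distinguishable, i.e. for which there is a measurement $\{e_1,\dots,e_m\}$ with $e_i(\omega_j)=\delta_{ij}$. Preparation-measurement reciprocity: for every pure state $\omega$ there exists a unique extremal effect $e_\omega$ (other than the trivial effect $u$) with $e_\omega(\omega)=1$. *)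

(* Defs.v *)
(* MathComp / MathComp-Analysis *)
From HB Require Import structures.
From mathcomp Require Import all_boot all_order all_algebra.
From mathcomp Require Import all_classical all_reals all_analysis.

Set Implicit Arguments.
Unset Strict Implicit.
Unset Printing Implicit Defensive.

Import Order.TTheory GRing.Theory Num.Theory.
Import numFieldNormedType.Exports.

Local Open Scope classical_set_scope.
Local Open Scope ring_scope.

Definition extreme_point (R : realType) (V : lmodType R) (K : set V) (x : V) :=
  K x /\ forall (y z : V) (t : R), K y -> K z -> 0 < t < 1 ->
    x = t *: y + (1 - t) *: z -> y = x /\ z = x.

(* The ambient space is V = R^n, as row vectors; its linear functionals are the
   column vectors e, acting by w |-> w *m e. *)
Definition app (R : realType) (n : nat) (e : 'cV[R]_n) (w : 'rV[R]_n) : R :=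
  (w *m e) ord0 ord0.

(* The states are not required to span R^n.  If they do not, adding to an
   effect any nonzero functional that vanishes on all states gives another effect, so
   there are no extremal effects; thus [reciprocity] below forces spanning as
   soon as there is a pure state, and then [unit_effect] is the only functional equal
   to 1 on all states and the set of effects is compact. *)
Record gps (R : realType) := Gps {
  gdim : nat;
  states : set 'rV[R]_gdim;
  unit_effect : 'cV[R]_gdim;
  states_convex : convex_set states;
  states_compact : compact states;
  unit_effectP : forall w, states w -> app unit_effect w = 1
}.

Definition effects (R : realType) (S : gps R) : set 'cV[R]_(gdim S) :=
  [set e | forall w, states w -> 0 <= app e w <= 1].

Definition pure_state (R : realType) (S : gps R) (w : 'rV[R]_(gdim S)) :=
  extreme_point (@states R S) w.

Definition extremal_effect (R : realType) (S : gps R) (e : 'cV[R]_(gdim S)) :=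
  extreme_point (@effects R S) e.

(* A measurement with outcome set I; a dichotomic one has I = bool, with [true]
   standing for the outcome + and [false] for -. *)
Definition measurement (R : realType) (S : gps R) (I : finType)
    (e : I -> 'cV[R]_(gdim S)) :=
  (forall i, effects (e i)) /\ \sum_i e i = unit_effect S.

Definition distinguishable (R : realType) (S : gps R) (m : nat)
    (w : 'I_m -> 'rV[R]_(gdim S)) :=
  exists2 e : 'I_m -> 'cV[R]_(gdim S), measurement e &
    forall i j, app (e i) (w j) = (i == j)%:R.

Definition operational_dimension (R : realType) (S : gps R) (d : nat) :=
  let attained m := exists2 w : 'I_m -> 'rV[R]_(gdim S),
    (forall i, states (w i)) & distinguishable w in
  attained d /\ forall m, attained m -> (m <= d)%N.

Definition reciprocity (R : realType) (S : gps R) :=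
  forall w : 'rV[R]_(gdim S), pure_state w ->
    exists! e : 'cV[R]_(gdim S),
      [/\ extremal_effect e, e <> unit_effect S & app e w = 1].

(* R^m (x) R^n is the space of m x n matrices: a (x) b is the matrix of entries
   a_i b_j, and e (x) f is the functional W |-> sum_(i, j) e_i W_ij f_j. *)
Definition tens (R : realType) (m n : nat) (a : 'rV[R]_m) (b : 'rV[R]_n) :
    'M[R]_(m, n) :=
  a^T *m b.

Definition joint_prob (R : realType) (m n : nat) (W : 'M[R]_(m, n))
    (e : 'cV[R]_m) (f : 'cV[R]_n) : R :=
  (e^T *m W *m f) ord0 ord0.

Lemma joint_prob_tens (R : realType) (m n : nat) (a : 'rV[R]_m) (b : 'rV[R]_n)
    (e : 'cV[R]_m) (f : 'cV[R]_n) :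
  joint_prob (tens a b) e f = app e a * app f b.
Proof.
rewrite /joint_prob /tens /app mulmxA -trmx_mul -mulmxA mxE big_ord1.
by rewrite mxE.
Qed.

Record composition (R : realType) (A B : gps R) := Composition {
  bistates : set 'M[R]_(gdim A, gdim B);
  bistates_convex : convex_set bistates;
  bistates_compact : compact bistates;
  bistates_unit : forall W, bistates W -> joint_prob W (unit_effect A) (unit_effect B) = 1;
  bistates_ge0 : forall W e f,
    bistates W -> effects e -> effects f -> 0 <= joint_prob W e f;
  bistates_tens : forall a b, states a -> states b -> bistates (tens a b)
}.

Definition product_state (R : realType) (A B : gps R)
    (W : 'M[R]_(gdim A, gdim B)) :=
  exists a b, [/\ states a, states b & W = tens a b].

Definition pure_bistate (R : realType) (A B : gps R) (AB : composition A B)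
    (W : 'M[R]_(gdim A, gdim B)) :=
  extreme_point (bistates AB) W.

Definition pure_entangled (R : realType) (A B : gps R) (AB : composition A B)
    (W : 'M[R]_(gdim A, gdim B)) :=
  pure_bistate AB W /\ ~ product_state W.

Definition hardy_nonlocal (R : realType) (A B : gps R)
    (W : 'M[R]_(gdim A, gdim B)) :=
  exists (E1 E2 : bool -> 'cV[R]_(gdim A)) (F1 F2 : bool -> 'cV[R]_(gdim B)),
    [/\ measurement E1, measurement E2, measurement F1 & measurement F2] /\
    [/\ 0 < joint_prob W (E1 true) (F1 true),
        joint_prob W (E1 true) (F2 true) = 0,
        joint_prob W (E2 true) (F1 true) = 0 &
        joint_prob W (E2 false) (F2 false) = 0].

(* Main.v *)
Require Import Defs.
From mathcomp Require Import all_boot all_order all_algebra.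
From mathcomp Require Import all_classical all_reals all_analysis.
From mathcomp Require Import ring lra.
Set Implicit Arguments.
Unset Strict Implicit.
Unset Printing Implicit Defensive.

Import Order.TTheory GRing.Theory Num.Theory.
Import numFieldNormedType.Exports.
Local Open Scope ring_scope.

(* Reciprocity makes the effects equal to 1 at a pure state the segment from u
   to one other effect; so the effects vanishing at a pure state lie on one
   ray. All terms being nonnegative, the zero conditions on W hold for Phi and
   for the product state a (x) b. The product state satisfies no Hardy
   paradox, so P(E1+, F1+) > 0 on Phi. By the fourth condition E2-(a) = 0 or
   F2-(b) = 0, say the former; then E2+(a) = 1 gives F1+(b) = 0, and E1+(a) =
   0 or F2+(b) = 0. In the latter case F1+ and F2+ are on the same ray; in the
   former E1+ and E2- are. Proportional effects have the same zeros on Phi,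
   which gives P(E1+, F1+) = 0. *)

(** * Linear functionals and the Euclidean inner product *)

Lemma appDl (R : realType) n (e f : 'cV[R]_n) w :
  app (e + f) w = app e w + app f w.
Proof. by rewrite /app mulmxDr mxE. Qed.

Lemma appZl (R : realType) n c (e : 'cV[R]_n) w : app (c *: e) w = c * app e w.
Proof. by rewrite /app -scalemxAr mxE. Qed.

Lemma appBl (R : realType) n (e f : 'cV[R]_n) w :
  app (e - f) w = app e w - app f w.
Proof. by rewrite appDl -scaleN1r appZl mulN1r. Qed.

Lemma app_sum (R : realType) n (e : 'cV[R]_n) w :
  app e w = \sum_j w ord0 j * e j ord0.
Proof. by rewrite /app mxE. Qed.

Definition dot (R : realType) n (x y : 'rV[R]_n) : R := app x^T y.

Lemma dotC (R : realType) n (x y : 'rV[R]_n) : dot x y = dot y x.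
Proof.
by rewrite /dot !app_sum; apply: eq_bigr => j _; rewrite !mxE mulrC.
Qed.

Lemma dotDl (R : realType) n (x y z : 'rV[R]_n) :
  dot (x + y) z = dot x z + dot y z.
Proof. by rewrite /dot raddfD appDl. Qed.

Lemma dotZl (R : realType) n c (x z : 'rV[R]_n) : dot (c *: x) z = c * dot x z.
Proof. by rewrite /dot linearZ appZl. Qed.

Lemma dotNl (R : realType) n (x z : 'rV[R]_n) : dot (- x) z = - dot x z.
Proof. by rewrite -scaleN1r dotZl mulN1r. Qed.

Lemma dotDr (R : realType) n (x y z : 'rV[R]_n) :
  dot z (x + y) = dot z x + dot z y.
Proof. by rewrite dotC dotDl !(dotC z). Qed.

Lemma dotZr (R : realType) n c (x z : 'rV[R]_n) : dot z (c *: x) = c * dot z x.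
Proof. by rewrite dotC dotZl dotC. Qed.

Lemma dotNr (R : realType) n (x z : 'rV[R]_n) : dot z (- x) = - dot z x.
Proof. by rewrite dotC dotNl dotC. Qed.

Definition dotE := (dotDl, dotDr, dotZl, dotZr, dotNl, dotNr).

Lemma dot_ge0 (R : realType) n (x : 'rV[R]_n) : 0 <= dot x x.
Proof.
rewrite /dot app_sum; apply: sumr_ge0 => j _.
by rewrite mxE -expr2 sqr_ge0.
Qed.

Lemma dot_eq0 (R : realType) n (x : 'rV[R]_n) : dot x x = 0 -> x = 0.
Proof.
rewrite /dot app_sum => x0; apply/rowP => j; rewrite mxE.
have ge0 i : true -> 0 <= x ord0 i * x^T i ord0.
  by rewrite mxE -expr2 sqr_ge0.
have /(_ j isT)/eqP := psumr_eq0P ge0 x0.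
by rewrite mxE -expr2 sqrf_eq0 => /eqP.
Qed.

(** * Extreme points of compact sets *)

Lemma continuous_sum (R : realType) (T : topologicalType) (I : Type)
    (r : seq I) (F : I -> T -> R) :
  (forall i, continuous (F i)) -> continuous (fun x => \sum_(i <- r) F i x).
Proof.
move=> cF; apply: (@continuous_big R I +%R 0 xpredT) => [|i _]; last exact: cF.
exact: add_continuous.
Qed.

Lemma continuous_dot (R : realType) n (c : 'rV[R]_n) :
  continuous (fun x => dot x c).
Proof.
move=> x; rewrite (_ : (fun x => dot x c) =
    fun x => \sum_j c ord0 j * x ord0 j); last first.
  apply/funext => y; rewrite /dot app_sum.
  by apply: eq_bigr => j _; rewrite mxE.
apply: continuous_sum => j {}x.
apply: (@continuousM _ _ (fun=> c ord0 j) (fun x : 'rV[R]_n => x ord0 j)).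
  exact: cst_continuous.
exact: coord_continuous.
Qed.

Lemma continuous_dot_sqr (R : realType) n :
  continuous (fun x : 'rV[R]_n => dot x x).
Proof.
move=> x; rewrite (_ : (fun x => _) =
    fun x : 'rV[R]_n => \sum_j x ord0 j * x ord0 j); last first.
  apply/funext => y; rewrite /dot app_sum.
  by apply: eq_bigr => j _; rewrite mxE.
apply: continuous_sum => j {}x.
by apply: (@continuousM _ _ (fun x : 'rV[R]_n => x ord0 j));
  exact: coord_continuous.
Qed.

(* A maximizer of a strictly convex function is an extreme point. *)
Lemma compact_farthest_extreme (R : realType) n (K : set 'rV[R]_n)
    (c : 'rV[R]_n) :
    compact K -> (K !=set0)%classic ->
  exists2 v, extreme_point K v &
    forall z, K z -> dot z z + dot z c <= dot v v + dot v c.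
Proof.
move=> cK K0.
(* Up to a constant, the objective is the squared distance from -c/2. *)
have [|v vK vmax] := @compact_EVT_max _ R (fun z => dot z z + dot z c) K K0 cK.
  apply: continuous_subspaceT => z.
  apply: (@continuousD _ _ _ (fun z => dot z z) (fun z => dot z c)).
    exact: continuous_dot_sqr.
  exact: continuous_dot.
move: vK; rewrite inE => vK.
have vm z : K z -> dot z z + dot z c <= dot v v + dot v c.
  by move=> Kz; apply: vmax; rewrite inE.
exists v => //; split=> // y z t Ky Kz /andP[t0 t1] vE.
have yz : dot (y - z) (y - z) = 0.
  apply/eqP; rewrite eq_le dot_ge0 andbT.
  have ty : t * (dot y y + dot y c) <= t * (dot v v + dot v c).
    by rewrite ler_pM2l // vm.
  have tz : (1 - t) * (dot z z + dot z c) <= (1 - t) * (dot v v + dot v c).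
    by rewrite ler_pM2l ?subr_gt0 // vm.
  have tt : 0 < t * (1 - t) by rewrite mulr_gt0 // subr_gt0.
  rewrite -(ler_pM2l tt) mulr0.
  (* The convexity defect of |z|^2 is t (1 - t) |y - z|^2; as [v] is a maximizer, it cannot be
     positive. *)
  have E : dot v v + dot v c = t * (dot y y + dot y c)
      + (1 - t) * (dot z z + dot z c) - t * (1 - t) * dot (y - z) (y - z).
    rewrite vE !dotE (dotC z y); ring.
  lra.
have /subr0_eq yzE := dot_eq0 yz.
by move: vE; rewrite yzE -scalerDl addrC subrK scale1r => ->.
Qed.

(** This [s] minimizes s^2 b - 2 s a on [0, 1]; the two inequalities are the optimality conditions
    against the endpoints 0 and 1. *)
Lemma clamp_exists (R : realFieldType) (a b : R) : 0 <= b ->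
  exists2 s, 0 <= s <= 1 &
    (0 <= s * (a - s * b)) && ((1 - s) * (a - s * b) <= 0).
Proof.
move=> b0; case: (leP a 0) => a0; first by exists 0; lra.
case: (leP b a) => ab; first by exists 1; lra.
have b_gt0 : 0 < b by lra.
exists (a / b).
  by rewrite divr_ge0 ?(ltW a0) //= ler_pdivrMr // mul1r ltW.
by rewrite divfK ?gt_eqF // subrr !mulr0 lexx.
Qed.

(* If z were off the segment, a large enough ball would contain x and y but not
   z, and the point of K farthest from its centre would be a third extreme
   point.  The centre lies far away on the ray from z through the point p of the
   segment nearest to z. *)
Lemma two_extreme_points_segment (R : realType) n (K : set 'rV[R]_n) x y z :
    compact K -> (forall v, extreme_point K v -> v = x \/ v = y) -> K z ->
  exists2 s, 0 <= s <= 1 & z = x + s *: (y - x).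
Proof.
move=> cK Kxy Kz.
have [s s01 /andP[s1 s2]] :=
  clamp_exists (dot (y - x) (z - x)) (dot_ge0 (y - x)).
set p := x + s *: (y - x).
(* As [p] is nearest to [z] on the segment, the directions from [p] to the endpoints make no acute
   angle with [z - p]. *)
have xp : dot (x - p) (z - p) <= 0.
  rewrite (_ : dot _ _ =
    - (s * (dot (y - x) (z - x) - s * dot (y - x) (y - x)))).
    by rewrite oppr_le0.
  rewrite /p !dotE; ring.
have yp : dot (y - p) (z - p) <= 0.
  rewrite (_ : dot _ _ =
    (1 - s) * (dot (y - x) (z - x) - s * dot (y - x) (y - x))) //.
  by rewrite /p !dotE; ring.
exists s => //; rewrite -/p; clearbody p.
apply/subr0_eq/dot_eq0/eqP; apply: contraT => zp0.
have zp : 0 < dot (z - p) (z - p) by rewrite lt_def zp0 dot_ge0.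
(* The ball is centred at p - T (z - p). Up to a constant, the squared distance of q from there is
   |q - p|^2 + 2 T <q - p, z - p>; with this [T] its value at [z] exceeds those at [x] and [y]. *)
pose T := (dot (x - p) (x - p) + dot (y - p) (y - p)) / dot (z - p) (z - p).
have TE : T * dot (z - p) (z - p) = dot (x - p) (x - p) + dot (y - p) (y - p).
  by rewrite divfK // gt_eqF.
have T0 : 0 <= T by rewrite divr_ge0 ?addr_ge0 ?dot_ge0.
have [v /Kxy vxy vmax] := @compact_farthest_extreme R n K
  ((2 * T) *: (z - p) - 2 *: p) cK (ex_intro _ z Kz).
have := vmax z Kz; have := dot_ge0 (x - p); have := dot_ge0 (y - p).
have key q : dot (q - p) (z - p) <= 0 ->
    dot z z + dot z ((2 * T) *: (z - p) - 2 *: p) <=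
    dot q q + dot q ((2 * T) *: (z - p) - 2 *: p) ->
    dot (z - p) (z - p) + 2 * (T * dot (z - p) (z - p)) <= dot (q - p) (q - p).
  move=> qp; rewrite -subr_ge0 (_ : _ - _ = dot (q - p) (q - p)
      + 2 * (T * dot (q - p) (z - p))
      - (dot (z - p) (z - p) + 2 * (T * dot (z - p) (z - p)))).
    have : T * dot (q - p) (z - p) <= 0 by rewrite mulr_ge0_le0.
    lra.
  rewrite !dotE (dotC p q) (dotC p z); ring.
by case: vxy => -> ? ?; [move=> /(key x xp) | move=> /(key y yp)];
  rewrite TE; lra.
Qed.

(** * Compactness of the set of effects *)

(** States are added as rows one at a time, each raising the rank, until it reaches [gdim S]. *)
Lemma separating_states_row_full (R : realType) (S : gps R) :
    (forall v, (forall w, @states R S w -> app v w = 0) -> v = 0) ->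
  exists m (M : 'M[R]_(m, gdim S)),
    (forall i, states (row i M)) /\ row_full M.
Proof.
move=> sep.
suff /(_ (gdim S) (leqnn _)) [m [M [MS rM]]] : forall k, (k <= gdim S)%N ->
    exists m (M : 'M[R]_(m, gdim S)),
      (forall i, states (row i M)) /\ (k <= \rank M)%N.
  by exists m, M; rewrite -col_leq_rank.
elim=> [_|k IH kn]; first by exists 0%N, 0; split=> [[]|].
have [m [M [MS rM]]] := IH (ltnW kn).
case: (ltnP k (\rank M)) => [|rMk]; first by exists m, M.
have /negP rfM : ~~ row_full M.
  by rewrite -col_leq_rank -ltnNge (leq_ltn_trans rMk).
(* Were all states in the row space of [M], the columns of [cokermx M] would vanish on them, hence
   be zero. *)
have [w Sw wM] : exists2 w, @states R S w & ~~ (w <= M)%MS.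
  apply: contrapT => no; apply: rfM.
  rewrite -sub1mx submxE mul1mx; apply/eqP/matrixP => i j.
  rewrite [RHS]mxE; suff /colP/(_ i) : col j (cokermx M) = 0 by rewrite !mxE.
  apply: sep => w Sw; apply/eqP; apply: contraT => wj.
  case: no; exists w => //; rewrite submxE; apply: contra wj => /eqP wM.
  by rewrite /app colE mulmxA wM mul0mx mxE.
exists (m + 1)%N, (col_mx M w); split=> [i|].
  by rewrite -(splitK i); case: (fintype.split i) => j /=;
    rewrite ?rowKu ?rowKd // row_id.
apply: (leq_ltn_trans rM); apply: rank_ltmx.
have := submx_refl (col_mx M w); rewrite col_mx_sub => /andP[Mle _].
by rewrite ltmxE Mle col_mx_sub (negPf wM) andbF.
Qed.

(** A nonzero such [v] would make [e] the midpoint of two distinct effects [e + v] and [e - v]. *)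
Lemma extremal_effect_separating (R : realType) (S : gps R)
    (e v : 'cV[R]_(gdim S)) :
  extremal_effect e -> (forall w, @states R S w -> app v w = 0) -> v = 0.
Proof.
move=> [eff ext] v0.
have h : 0 < (2^-1 : R) < 1 by lra.
have effD : effects (e + v).
  by move=> w Sw; rewrite appDl v0 // addr0; exact: eff.
have effB : effects (e - v).
  by move=> w Sw; rewrite appBl v0 // subr0; exact: eff.
have eE : e = 2^-1 *: (e + v) + (1 - 2^-1) *: (e - v).
  by apply/matrixP => i j; rewrite !mxE; lra.
have [evE _] := ext _ _ _ effD effB h eE.
by apply: (addrI e); rewrite addr0.
Qed.

(** Each state imposes a closed condition. The values at spanning states lie in [0, 1], and a left
    inverse of [M] recovers the coordinates from them, so these are bounded by the l1 norms [C i] of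
    its rows. *)
Lemma compact_effects (R : realType) (S : gps R) :
    (forall v, (forall w, @states R S w -> app v w = 0) -> v = 0) ->
  compact [set x : 'rV[R]_(gdim S) | effects x^T]%classic.
Proof.
move=> /separating_states_row_full[m [M [MS fM]]].
pose C i := \sum_j `|pinvmx M i j|.
apply: (@subclosed_compact _ _
    [set x : 'rV[R]_(gdim S) |
      forall i, `[- C i, C i]%classic (x ord0 i)]%classic).
- move=> x clx w Sw.
  pose D := ((fun x => dot x w) @^-1` `[0, 1] : set 'rV[R]_(gdim S))%classic.
  have cD : closed D.
    apply: preimage_closed => [y _|]; first exact: continuous_dot.
    exact: itv_closed.
  have : D x.
    apply/cD/(closureS _ clx) => y /(_ w Sw).
    by rewrite /D /= in_itv.
  by rewrite /D /= in_itv.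
- apply: (@rV_compact _ _ (fun i => `[- C i, C i]%classic)) => i.
  exact: segment_compact.
- move=> x ex i; rewrite /= in_itv /= -ler_norml.
  have -> : x ord0 i = \sum_j pinvmx M i j * app x^T (row j M).
    transitivity ((pinvmx M *m (M *m x^T)) i ord0).
      by rewrite mulmxA mulVpmx // mul1mx mxE.
    rewrite mxE; apply: eq_bigr => j _; congr (_ * _).
    by rewrite /app -row_mul [RHS]mxE.
  apply: (le_trans (ler_norm_sum _ _ _)); apply: ler_sum => j _.
  rewrite normrM ler_piMr // ger0_norm; by case/andP: (ex _ (MS j)).
Qed.

(** * Effects vanishing at a pure state *)

Lemma effects_unitB (R : realType) (S : gps R) (e : 'cV[R]_(gdim S)) :
  effects e -> effects (unit_effect S - e).
Proof.
by move=> ee w Sw; rewrite appBl unit_effectP //; have := ee w Sw; lra.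
Qed.

(* The effects equal to 1 at w form a compact face whose only extreme points
   are the unit effect and the one given by reciprocity. *)
Lemma reciprocity_null_effects (R : realType) (S : gps R)
    (w : 'rV[R]_(gdim S)) :
    reciprocity S -> pure_state w ->
  exists c, forall e, effects e -> app e w = 0 -> exists q, e = q *: c.
Proof.
move=> rec pw; have [ew [[ext _ _] uniq]] := rec w pw.
have Sw : states w by case: pw.
pose u := unit_effect S.
(* The complement [u - e] is 1 at [w], so it will lie on the segment from [u] to [ew], making [e] a
   multiple of [u - ew]. *)
exists (u - ew) => e effe ew0.
pose K := [set x : 'rV[R]_(gdim S) | effects x^T /\ app x^T w = 1]%classic.
have cK : compact K.
  apply: (@subclosed_compact _ _
      [set x : 'rV[R]_(gdim S) | effects x^T]%classic); last by move=> x [].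
    rewrite (_ : K = [set x : 'rV[R]_(gdim S) | effects x^T] `&`
        (fun x => dot x w) @^-1` [set x | x = 1])%classic //.
    apply: closedI.
      apply: compact_closed; first exact: norm_hausdorff.
      by apply: compact_effects => v; exact: (extremal_effect_separating ext).
    apply: preimage_closed => [y _|]; first exact: continuous_dot.
    exact: closed_eq.
  by apply: compact_effects => v; exact: (extremal_effect_separating ext).
have Kext v : extreme_point K v -> v = u^T \/ v = ew^T.
  move=> [[effv v1] extv].
  have [vu|vu] := pselect (v^T = u); first by left; rewrite -vu trmxK.
  right; rewrite -[v]trmxK; congr (_^T)%R; apply/esym/uniq; split=> //.
  split=> // y z t effy effz /andP[t0 t1] vE.
  (* Both values are at most 1 and average to 1, so [y] and [z] lie in the face too; its extreme
     points are thus extremal effects. *)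
  have [y1 z1] : app y w = 1 /\ app z w = 1.
    have := v1; rewrite vE appDl !appZl.
    have /andP[_ y1] := effy w Sw; have /andP[_ z1] := effz w Sw.
    have ty : t * app y w <= t by rewrite -[leRHS]mulr1 ler_pM2l.
    have tz : (1 - t) * app z w <= 1 - t.
      by rewrite -[leRHS]mulr1 ler_pM2l // subr_gt0.
    move=> sum1; split.
      by apply: (mulfI (lt0r_neq0 t0)); lra.
    have t1' : 1 - t != 0 by rewrite gt_eqF // subr_gt0.
    by apply: (mulfI t1'); lra.
  have Ky : K y^T by split; rewrite trmxK.
  have Kz : K z^T by split; rewrite trmxK.
  have vE' : v = t *: y^T + (1 - t) *: z^T.
    by rewrite -[LHS]trmxK vE linearD !linearZ.
  have t01 : 0 < t < 1 by rewrite t0.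
  have [yv zv] := extv _ _ t Ky Kz t01 vE'.
  by split; [rewrite -yv|rewrite -zv]; rewrite trmxK.
have [|q _ qE] := @two_extreme_points_segment _ _ K _ _ (u - e)^T cK Kext.
  split; rewrite trmxK; first exact: effects_unitB.
  by rewrite appBl ew0 subr0 unit_effectP.
exists q; move: qE; rewrite -linearB -linearZ -linearD => /trmx_inj qE.
apply/oppr_inj/(addrI u); rewrite qE.
by rewrite -scalerN opprB.
Qed.

(** * Joint probabilities: bilinearity and monotonicity *)

Lemma joint_probDl (R : realType) m n (W : 'M[R]_(m, n)) e e' f :
  joint_prob W (e + e') f = joint_prob W e f + joint_prob W e' f.
Proof. by rewrite /joint_prob linearD !mulmxDl mxE. Qed.

Lemma joint_probZl (R : realType) m n (W : 'M[R]_(m, n)) c e f :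
  joint_prob W (c *: e) f = c * joint_prob W e f.
Proof. by rewrite /joint_prob linearZ -!scalemxAl mxE. Qed.

Lemma joint_prob_tr (R : realType) m n (W : 'M[R]_(m, n)) e f :
  joint_prob W^T f e = joint_prob W e f.
Proof.
by rewrite /joint_prob -trmx_mul -[e in LHS]trmxK -trmx_mul [LHS]mxE mulmxA.
Qed.

Lemma joint_probDr (R : realType) m n (W : 'M[R]_(m, n)) e f f' :
  joint_prob W e (f + f') = joint_prob W e f + joint_prob W e f'.
Proof. by rewrite -(joint_prob_tr W) joint_probDl !(joint_prob_tr W). Qed.

Lemma joint_probZr (R : realType) m n (W : 'M[R]_(m, n)) c e f :
  joint_prob W e (c *: f) = c * joint_prob W e f.
Proof. by rewrite -(joint_prob_tr W) joint_probZl (joint_prob_tr W). Qed.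

Lemma joint_prob_mixture (R : realType) m n (W W' : 'M[R]_(m, n)) s t e f :
  joint_prob (s *: W + t *: W') e f =
    s * joint_prob W e f + t * joint_prob W' e f.
Proof.
by rewrite /joint_prob mulmxDr mulmxDl mxE -!scalemxAr -!scalemxAl !mxE.
Qed.

Lemma joint_prob_unitBr (R : realType) (A B : gps R)
    (W : 'M[R]_(gdim A, gdim B)) e f :
  joint_prob W e (unit_effect B - f) =
    joint_prob W e (unit_effect B) - joint_prob W e f.
Proof. by rewrite joint_probDr -scaleN1r joint_probZr mulN1r. Qed.

Lemma joint_prob_unitBl (R : realType) (A B : gps R)
    (W : 'M[R]_(gdim A, gdim B)) e f :
  joint_prob W (unit_effect A - e) f =
    joint_prob W (unit_effect A) f - joint_prob W e f.
Proof. by rewrite joint_probDl -scaleN1r joint_probZl mulN1r. Qed.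

(** Positivity is assumed directly, not through a composition, so that the transpose of a bipartite
    state is covered as well. *)
Lemma joint_prob_le_unitr (R : realType) (A B : gps R)
    (W : 'M[R]_(gdim A, gdim B)) e f :
    (forall e f, effects e -> effects f -> 0 <= joint_prob W e f) ->
    effects e -> effects f ->
  joint_prob W e f <= joint_prob W e (unit_effect B).
Proof.
move=> W_ge0 ee ef; rewrite -subr_ge0 -joint_prob_unitBr.
by apply: W_ge0 => //; exact: effects_unitB.
Qed.

Lemma joint_prob_le_unitl (R : realType) (A B : gps R)
    (W : 'M[R]_(gdim A, gdim B)) e f :
    (forall e f, effects e -> effects f -> 0 <= joint_prob W e f) ->
    effects e -> effects f ->
  joint_prob W e f <= joint_prob W (unit_effect A) f.
Proof.
move=> W_ge0 ee ef; rewrite -subr_ge0 -joint_prob_unitBl.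
by apply: W_ge0 => //; exact: effects_unitB.
Qed.

(** * Hardy's conditions and proportional effects *)

(** This is the case where [unit_effect A - e2] vanishes at [a]; the other case follows by
    exchanging the systems. *)
Lemma hardy_zero_of_rays (R : realType) (A B : gps R)
    (W : 'M[R]_(gdim A, gdim B)) a b cA cB e1 e2 f1 f2 :
    (forall e f, effects e -> effects f -> 0 <= joint_prob W e f) ->
    (forall e, effects e -> app e a = 0 -> exists q, e = q *: cA) ->
    (forall f, effects f -> app f b = 0 -> exists q, f = q *: cB) ->
    states a -> effects e1 -> effects e2 -> effects f1 -> effects f2 ->
    app e2 a = 1 -> app f1 b = 0 -> app e1 a * app f2 b = 0 ->
    joint_prob W e1 f2 = 0 -> joint_prob W e2 f1 = 0 ->
    joint_prob W (unit_effect A - e2) (unit_effect B - f2) = 0 ->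
  joint_prob W e1 f1 = 0.
Proof.
move=> W_ge0 rayA rayB Sa ee1 ee2 ef1 ef2 e2a f1b e1f2 W12 W21 W22.
have ee2' := effects_unitB ee2; have ef2' := effects_unitB ef2.
have [p e2E] : exists p, unit_effect A - e2 = p *: cA.
  by apply: rayA => //; rewrite appBl unit_effectP // e2a subrr.
have [q f1E] := rayB _ ef1 f1b.
have W11 := W_ge0 _ _ ee1 ef1.
have W11l := joint_prob_le_unitl W_ge0 ee1 ef1.
have W11r := joint_prob_le_unitr W_ge0 ee1 ef1.
have W21' := joint_prob_le_unitr W_ge0 ee2' ef1.
have W21u := joint_prob_unitBl W e2 f1.
have W22u := joint_prob_unitBr W (unit_effect A - e2) f2.
move/eqP: e1f2; rewrite mulf_eq0 => /orP[] /eqP.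
- move=> /(rayA _ ee1)[s e1E].
  (* If [p] is 0 then [e2] is the unit effect u, so P(e1, f1) <= P(u, f1) = P(e2, f1) = 0. *)
  case: (eqVneq p 0) => [p0|p0].
    by move: W21u; rewrite e2E p0 scale0r -(scale0r cA) joint_probZl; lra.
  have WcA : joint_prob W cA (unit_effect B - f2) = 0.
    by apply: (mulfI p0); rewrite mulr0 -joint_probZl -e2E.
  have : joint_prob W e1 (unit_effect B - f2) = 0.
    by rewrite e1E joint_probZl WcA mulr0.
  rewrite joint_prob_unitBr; lra.
- move=> /(rayB _ ef2)[r f2E].
  (* If [r] is 0 then [f2] is 0, so P(u - e2, u) = 0, hence P(u - e2, f1) = 0 and P(u, f1) = 0. *)
  case: (eqVneq r 0) => [r0|r0].
    have : joint_prob W (unit_effect A - e2) f2 = 0.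
      by rewrite f2E r0 joint_probZr mul0r.
    lra.
  rewrite f1E joint_probZr; apply/eqP; rewrite mulf_eq0; apply/orP; right.
  by apply/eqP/(mulfI r0); rewrite mulr0 -joint_probZr -f2E.
Qed.

(** * Purity of the factors of a product state *)

(** Tensoring with [b] turns a decomposition of [a] into one of the product state; contracting with
    the unit effect returns the factor. *)
Lemma tens_pure_left (R : realType) (A B : gps R) (AB : composition A B) a b :
    states a -> states b -> pure_bistate AB (tens a b) ->
  @pure_state R A a.
Proof.
move=> Sa Sb [_ ext]; split=> // y z t Sy Sz t01 aE.
have [|tE zE] := ext _ _ t (bistates_tens AB Sy Sb)
  (bistates_tens AB Sz Sb) t01.
  by rewrite aE /tens linearD !linearZ /= mulmxDl -!scalemxAl.
have tensu (x : 'rV[R]_(gdim A)) : tens x b *m unit_effect B = x^T.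
  have bu : b *m unit_effect B = 1%:M.
    by apply/matrixP => i j; rewrite !ord1 [RHS]mxE; exact: unit_effectP.
  by rewrite /tens -mulmxA bu mulmx1.
by split; apply: trmx_inj; rewrite -!tensu ?tE ?zE.
Qed.

Lemma tens_pure_right (R : realType) (A B : gps R) (AB : composition A B) a b :
    states a -> states b -> pure_bistate AB (tens a b) ->
  @pure_state R B b.
Proof.
move=> Sa Sb [_ ext]; split=> // y z t Sy Sz t01 bE.
have [|tE zE] := ext _ _ t (bistates_tens AB Sa Sy)
  (bistates_tens AB Sa Sz) t01.
  by rewrite bE /tens mulmxDr -!scalemxAr.
have tensu (x : 'rV[R]_(gdim B)) : (unit_effect A)^T *m tens a x = x.
  have au : (unit_effect A)^T *m a^T = 1%:M.
    apply/matrixP => i j.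
    by rewrite -trmx_mul !ord1 [LHS]mxE [RHS]mxE; exact: unit_effectP.
  by rewrite /tens mulmxA au mul1mx.
by split; rewrite -[LHS]tensu -[RHS]tensu ?tE ?zE.
Qed.

(** * Hardy's conditions on the mixture *)

Lemma measurement_bool (R : realType) (S : gps R)
    (E : bool -> 'cV[R]_(gdim S)) :
  measurement E -> effects (E true) /\ E false = unit_effect S - E true.
Proof.
move=> [eff sum]; split; first exact: eff.
by rewrite -sum big_bool /= addrAC subrr add0r.
Qed.

Theorem theorem3 (R : realType) (A B : gps R) (AB : composition A B)
    (odA : operational_dimension A 2) (odB : operational_dimension B 2)
    (recA : reciprocity A) (recB : reciprocity B)
    (Phi : 'M[R]_(gdim A, gdim B)) (hPhi : pure_entangled AB Phi)
    (wA : 'rV[R]_(gdim A)) (wB : 'rV[R]_(gdim B))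
    (hwA : states wA) (hwB : states wB) (hw : pure_bistate AB (tens wA wB))
    (eps : R) (heps : 0 < eps < 1) :
  ~ hardy_nonlocal (eps *: Phi + (1 - eps) *: tens wA wB).
Proof.
move=> [E1 [E2 [F1 [F2 [[mE1 mE2 mF1 mF2] []]]]]].
have [ee1 _] := measurement_bool mE1; have [ee2 ->] := measurement_bool mE2.
have [ef1 _] := measurement_bool mF1; have [ef2 ->] := measurement_bool mF2.
have ee2' := effects_unitB ee2; have ef2' := effects_unitB ef2.
have [[Phi_st _] _] := hPhi.
have Phi_ge0 e f := @bistates_ge0 _ _ _ AB _ e f Phi_st.
have tens_ge0 e f := @bistates_ge0 _ _ _ AB _ e f (bistates_tens AB hwA hwB).
have /andP[eps0 eps1] := heps.
have split0 e f : effects e -> effects f ->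
    joint_prob (eps *: Phi + (1 - eps) *: tens wA wB) e f = 0 ->
    joint_prob Phi e f = 0 /\ app e wA * app f wB = 0.
  move=> ee ef; rewrite -joint_prob_tens joint_prob_mixture => /eqP.
  rewrite paddr_eq0 ?mulr_ge0 ?Phi_ge0 ?tens_ge0 //
    ?(ltW eps0) ?subr_ge0 ?(ltW eps1) //.
  rewrite !mulf_eq0 (gt_eqF eps0) subr_eq0 (gt_eqF eps1) /=.
  by case/andP => /eqP -> /eqP ->.
move=> W11 /(split0 _ _ ee1 ef2)[P12 T12] /(split0 _ _ ee2 ef1)[P21 T21].
move=> /(split0 _ _ ee2' ef2')[P22 T22].
have [cA rayA] := reciprocity_null_effects recA (tens_pure_left hwA hwB hw).
have [cB rayB] := reciprocity_null_effects recB (tens_pure_right hwA hwB hw).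
move: T22; rewrite !appBl !unit_effectP // => T22.
move: W11; rewrite joint_prob_mixture joint_prob_tens.
have [P11 T11] : joint_prob Phi (E1 true) (F1 true) = 0 /\
    app (E1 true) wA * app (F1 true) wB = 0.
  (* Either [E2 true] is 1 at [wA] or [F2 true] is 1 at [wB]; then [T21] gives that [F1 true] is 0
     at [wB], or [T12] that [E1 true] is 0 at [wA]. *)
  move/eqP: T22; rewrite mulf_eq0 !subr_eq0 => /orP[] /eqP/esym h.
  - have f1 : app (F1 true) wB = 0 by rewrite -[LHS]mul1r -h.
    split; last by rewrite f1 mulr0.
    exact: (hardy_zero_of_rays Phi_ge0 rayA rayB hwA ee1 ee2 ef1 ef2).
  - have e1 : app (E1 true) wA = 0 by rewrite -[LHS]mulr1 -h.
    split; last by rewrite e1 mul0r.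
    (* Transposing [Phi] exchanges the roles of the two systems. *)
    have PhiT_ge0 f e : effects f -> effects e -> 0 <= joint_prob Phi^T f e.
      by move=> ef ee; rewrite joint_prob_tr Phi_ge0.
    rewrite -joint_prob_tr.
    apply: (hardy_zero_of_rays PhiT_ge0 rayB rayA hwB ef1 ef2 ee1 ee2);
      by rewrite ?joint_prob_tr // mulrC.
by rewrite P11 T11 !mulr0 addr0 ltxx.
Qed.
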